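(* Let $G$ be a group, let $A$ and $B$ be proper subgroups of $G$, and let $\phi:A\to B$ be an isomorphism. Let $G_*=\langle G,t \mid t^{-1}at=\phi(a),\ a\in A\rangle$ be the corresponding HNN extension of $G$. Then $G_*$ has infinite $C$-width.
   Context: For a group $G$ and a generating set $S$ of $G$, the length $l_S(g)$ of $g\in G$ is the minimum number of elements of $S\cup S^{-1}$ needed to express $g$ as a product, and the width of $G$ with respect to $S$ is $\mathrm{wid}(G,S)=\sup_{g\in G} l_S(g)\in\mathbb{N}\cup\{\infty\}$. A generating set $S$ is conjugation invariant if $g^{-1}sg\in S$ for all $s\in S$, $g\in G$. A group $G$ has finite $C$-width if $\mathrm{wid}(G,S)$ is finite for every conjugation invariant generating set $S$ of $G$; otherwise $G$ has infinite $C$-width. *)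

(* Defs.v *)
From HB Require Import structures.
From mathcomp Require Import all_boot all_classical.

Set Implicit Arguments.
Unset Strict Implicit.
Unset Printing Implicit Defensive.

Local Open Scope classical_set_scope.
Local Open Scope quotient_scope.
Local Open Scope group_scope.

Section Presentation.
Variable X : choiceType.

(* The letter (x, false) stands for x, and (x, true) for x^-1. *)
Definition word : Type := seq (X * bool).

Definition inv_word (w : word) : word := rev [seq (p.1, ~~ p.2) | p <- w].

Variable R : word -> word -> Prop.

Inductive word_eq : word -> word -> Prop :=
| WordRel u v of R u v : word_eq u v
| WordCancel x b : word_eq [:: (x, b); (x, ~~ b)] [::]
| WordCat u v u' v' of word_eq u v & word_eq u' v' :
    word_eq (u ++ u') (v ++ v')
| WordRefl u : word_eq u u
| WordSym u v of word_eq u v : word_eq v u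
| WordTrans u v w of word_eq u v & word_eq v w : word_eq u w.

Lemma word_eq_cancel u : word_eq (u ++ inv_word u) [::].
Proof.
elim: u => [|[x b] u IHu]; first exact: WordRefl.
rewrite /inv_word map_cons rev_cons -cats1 -cat1s catA -(catA [:: _]).
apply: (WordTrans (v := [:: (x, b)] ++ [::] ++ [:: (x, ~~ b)])).
  rewrite -catA; apply: WordCat; first exact: WordRefl.
  by apply: WordCat; [exact: IHu | exact: WordRefl].
exact: WordCancel.
Qed.

Lemma inv_wordK : involutive inv_word.
Proof.
move=> u; rewrite /inv_word map_rev revK -map_comp -[RHS]map_id.
by apply: eq_map => -[x b] /=; rewrite negbK.
Qed.

Lemma word_eq_inv u v : word_eq u v -> word_eq (inv_word u) (inv_word v).
Proof.
move=> uv; apply: (WordTrans (v := inv_word u ++ (v ++ inv_word v))).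
  rewrite -[X in word_eq X _]cats0; apply: WordCat; first exact: WordRefl.
  exact/WordSym/word_eq_cancel.
rewrite catA -[X in word_eq _ X]cat0s; apply: WordCat; last exact: WordRefl.
apply: (WordTrans (v := inv_word u ++ u)).
  by apply: WordCat; [exact: WordRefl | exact: WordSym].
by rewrite -[X in _ ++ X]inv_wordK; apply: word_eq_cancel.
Qed.

Definition word_eqb : rel word := fun u v => `[< word_eq u v >].

Lemma word_eqb_refl : reflexive word_eqb.
Proof. by move=> u; apply/asboolP; exact: WordRefl. Qed.

Lemma word_eqb_sym : symmetric word_eqb.
Proof. by move=> u v; apply/asboolP/asboolP; exact: WordSym. Qed.

Lemma word_eqb_trans : transitive word_eqb.
Proof.
by move=> v u w /asboolP uv /asboolP vw; apply/asboolP; exact: WordTrans vw.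
Qed.

Canonical word_equiv : equiv_rel word :=
  EquivRel word_eqb word_eqb_refl word_eqb_sym word_eqb_trans.

(* The group < X | u = v for all u, v such that R u v >. *)
Definition presented : Type := {eq_quot word_eqb}.

HB.instance Definition _ := Choice.on presented.
HB.instance Definition _ := EqQuotient.on presented.

Lemma presented_eqP u v : \pi_presented u = \pi_presented v <-> word_eq u v.
Proof. by split=> [/eqmodP/asboolP | uv]; last exact/eqmodP/asboolP. Qed.

Definition presented_one : presented := \pi_presented [::].
Definition presented_inv (x : presented) : presented :=
  \pi_presented (inv_word (repr x)).
Definition presented_mul (x y : presented) : presented :=
  \pi_presented (repr x ++ repr y).

Lemma pi_mul u v : presented_mul (\pi u) (\pi v) = \pi_presented (u ++ v).
Proof. by apply/presented_eqP/WordCat; apply/presented_eqP; rewrite reprK. Qed.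

Lemma pi_inv u : presented_inv (\pi u) = \pi_presented (inv_word u).
Proof. by apply/presented_eqP/word_eq_inv/presented_eqP; rewrite reprK. Qed.

Lemma presented_mulA : associative presented_mul.
Proof.
by move=> x y z; rewrite -[x]reprK -[y]reprK -[z]reprK !pi_mul catA.
Qed.

Lemma presented_1mul : left_id presented_one presented_mul.
Proof. by move=> x; rewrite -[x]reprK pi_mul. Qed.

Lemma presented_mul1 : right_id presented_one presented_mul.
Proof. by move=> x; rewrite -[x]reprK pi_mul cats0. Qed.

Lemma presented_mulV : right_inverse presented_one presented_inv presented_mul.
Proof.
move=> x; rewrite -[x]reprK pi_inv pi_mul.
exact/presented_eqP/word_eq_cancel.
Qed.

Lemma presented_Vmul : left_inverse presented_one presented_inv presented_mul.
Proof.
move=> x; rewrite -[x]reprK pi_inv pi_mul -{2}[repr x]inv_wordK.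
exact/presented_eqP/word_eq_cancel.
Qed.

HB.instance Definition _ := isGroup.Build presented
  presented_mulA presented_1mul presented_mul1 presented_Vmul presented_mulV.

End Presentation.

Definition subgroup (G : groupType) (H : set G) : Prop := group_closed [in H].

Definition subgroup_iso (G : groupType) (A B : set G) (phi : G -> G) : Prop :=
  set_bij A B phi /\ {in A &, {morph phi : x y / x * y}}.

Section HNN.
Variables (G : groupType) (A : set G) (phi : G -> G).

(* Generators: Some x for x in G, and None for the stable letter t. *)
Let base (x : G) : option G * bool := (Some x, false).
Let t : option G * bool := (None, false).
Let tV : option G * bool := (None, true).

(* G is presented by its multiplication table. *)
Inductive hnn_rel : word (option G) -> word (option G) -> Prop :=
| HNNMul x y : hnn_rel [:: base x; base y] [:: base (x * y)]
| HNNConj a of A a : hnn_rel [:: tV; base a; t] [:: base (phi a)].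

(* Only the values of phi on A matter. *)
Definition HNN : groupType := presented hnn_rel.

End HNN.

(* The least element of P, where None stands for infinity. *)
Definition least (P : set nat) : option nat :=
  if pselect (exists n, `[< P n >]) is left exP then Some (ex_minn exP)
  else None.

Section Width.
Variables (G : groupType) (S : set G).

Definition generates : Prop := smallest (@subgroup G) S = setT.

Definition conj_invariant : Prop := forall s g : G, S s -> S (s ^ g).

Definition expressible (g : G) (n : nat) : Prop :=
  exists s : seq G, [/\ size s = n,
    forall x, x \in s -> S x \/ S x^-1 & g = \big[*%g/1]_(x <- s) x].

Definition wlength (g : G) : option nat := least [set n | expressible g n].

(* The supremum of the lengths is their least upper bound. *)
Definition width : option nat :=
  least [set n | forall g, exists2 m, wlength g = Some m & (m <= n)%N].

End Width.

Definition finite_C_width (G : groupType) : Prop :=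
  forall S : set G, generates S -> conj_invariant S ->
  exists n, width S = Some n.

Definition infinite_C_width (G : groupType) : Prop := ~ finite_C_width G.

(* Main.v *)
Require Import Defs.
From mathcomp Require Import all_boot all_classical.
From mathcomp Require Import ssralg ssrnum ssrint zify.

(** Killing G and sending t to 1 respects the relations of the HNN extension,
    so the exponent sum of t is a homomorphism f onto the integers
    ([exponent_sumM], [exponent_sum_stable]).  Any group with such a
    homomorphism has infinite C-width ([infinite_C_width_of_hom_to_int]): the
    elements x with |f x| <= 1 form a generating set, which is conjugation
    invariant because conjugates have the same image in an abelian group; and
    a product of n of these elements or their inverses has |f| <= n, whereas f
    is unbounded. *)

Local Open Scope classical_set_scope.
Local Open Scope quotient_scope.
Local Open Scope group_scope.

Lemma subgroup_memX (G : groupType) (K : set G) (x : G) n :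
  subgroup K -> K x -> K (x ^+ n).
Proof.
move=> sgK Kx; apply: set_mem; elim: n => [|n IHn]; first exact: sgK.1.
by rewrite expgS (group_closedM sgK) // mem_set.
Qed.

Section HomToInt.
Variables (H : groupType) (f : H -> int).

Definition hom_to_int : Prop := forall x y, f (x * y) = (f x + f y)%R.

Lemma hom_to_int1 : hom_to_int -> f 1 = 0%R.
Proof. by move=> fM; move: (fM 1 1); rewrite mulg1; lia. Qed.

Lemma hom_to_intV x : hom_to_int -> f x^-1 = (- f x)%R.
Proof.
by move=> fM; move: (fM x x^-1); rewrite mulgV hom_to_int1 //; lia.
Qed.

Lemma hom_to_intX x n : hom_to_int -> f (x ^+ n) = (f x *+ n)%R.
Proof.
move=> fM; elim: n => [|n IHn]; first by rewrite expg0 hom_to_int1.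
by rewrite expgS fM IHn GRing.mulrS.
Qed.

Definition small_values : set H := [set x | (`|f x| <= 1)%N].

Lemma small_values_conj_invariant : hom_to_int -> conj_invariant small_values.
Proof.
move=> fM s g; rewrite /small_values /= conjgE !fM hom_to_intV //.
by rewrite [(f s + _)%R]GRing.addrC GRing.addKr.
Qed.

(** If f t = 1 and f x = n >= 0 then x t^-n has value 0, so x lies in the
    subgroup generated by the kernel of f and t. *)
Lemma small_values_generate t :
  hom_to_int -> f t = 1%R -> generates small_values.
Proof.
move=> fM ft1; rewrite /generates -subTset => x _ K [sgK SK].
have Kt : K t by apply: SK; rewrite /small_values /= ft1.
have nonneg y n : f y = Posz n -> K y.
  move=> fy; rewrite -(mulgVK (t ^+ n) y); apply: set_mem.
  apply: (group_closedM sgK); apply: mem_set; last exact: subgroup_memX.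
  apply: SK; rewrite /small_values /= fM hom_to_intV // hom_to_intX // ft1 fy.
  by rewrite natz; lia.
case fx: (f x) => [n|n]; first exact: nonneg fx.
rewrite -[x]invgK; apply: set_mem; apply: (group_closedV sgK); apply: mem_set.
by apply: (nonneg _ n.+1); rewrite hom_to_intV // fx; lia.
Qed.

Lemma expressible_small_values x n :
  hom_to_int -> expressible small_values x n -> (`|f x| <= n)%N.
Proof.
move=> fM [s [<- sS ->]] {x n}; elim: s sS => [|x s IHs] sS.
  by rewrite big_nil hom_to_int1.
rewrite big_cons fM /=.
have fx : (`|f x| <= 1)%N.
  by case: (sS x (mem_head _ _)); rewrite /small_values /= ?hom_to_intV //; lia.
have triangle (a b : int) k :
  (`|a| <= 1 -> `|b| <= k -> `|(a + b)%R| <= k.+1)%N by lia.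
exact: triangle fx (IHs (fun y ys => sS y (mem_behead (s := x :: s) ys))).
Qed.

End HomToInt.

Lemma least_Some (P : set nat) n : least P = Some n -> P n.
Proof.
rewrite /least; case: pselect => // exP [<-].
by case: ex_minnP => m /asboolP.
Qed.

(** The elements x with |f x| <= 1 witness infinite width: were n their width,
    t^(n+1), whose value is n+1, would be a product of at most n of them. *)
Lemma infinite_C_width_of_hom_to_int (H : groupType) (f : H -> int) (t : H) :
  hom_to_int H f -> f t = 1%R -> infinite_C_width H.
Proof.
move=> fM ft1 /(_ _ (small_values_generate _ _ _ fM ft1)
                    (small_values_conj_invariant _ _ fM)) [n].
move/least_Some => /(_ (t ^+ n.+1)) [m /least_Some /= tm mn].
have := expressible_small_values _ _ _ _ fM tm.
by rewrite hom_to_intX // ft1 natz; lia.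
Qed.

Section ExponentSum.
Variables (G : groupType) (A : set G) (phi : G -> G).

Definition letter_exponent (p : option G * bool) : int :=
  if p.1 is Some _ then 0%R else if p.2 then (-1)%R else 1%R.

Definition word_exponent_sum (w : word (option G)) : int :=
  (\sum_(p <- w) letter_exponent p)%R.

(** The relation t^-1 a t = phi a has exponent sum 0 on both sides because t^-1
    and t cancel; the multiplication table of G does not involve t. *)
Lemma word_exponent_sum_word_eq u v :
  word_eq (hnn_rel A phi) u v -> word_exponent_sum u = word_exponent_sum v.
Proof.
rewrite /word_exponent_sum.
elim=> {u v} [u v [x y|a _]|[x|] []|u v u' v' _ IHu _ IHv|//|//|u v w _ -> _ //];
  rewrite ?big_cons ?big_nil ?big_cat //=.
by rewrite IHu IHv.
Qed.

Definition exponent_sum (x : HNN A phi) : int :=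
  word_exponent_sum (repr (x : presented (hnn_rel A phi))).

Lemma exponent_sum_pi u :
  exponent_sum (\pi_(presented (hnn_rel A phi)) u) = word_exponent_sum u.
Proof.
by apply: word_exponent_sum_word_eq; apply/presented_eqP; rewrite reprK.
Qed.

Lemma exponent_sumM : hom_to_int (HNN A phi) exponent_sum.
Proof. by move=> x y; rewrite exponent_sum_pi /word_exponent_sum big_cat. Qed.

Definition stable_letter : HNN A phi :=
  \pi_(presented (hnn_rel A phi)) [:: (None, false)].

Lemma exponent_sum_stable : exponent_sum stable_letter = 1%R.
Proof. by rewrite exponent_sum_pi /word_exponent_sum big_seq1. Qed.

End ExponentSum.

Theorem theorem8 (G : groupType) (A B : set G) (phi : G -> G)
    (hA : subgroup A) (hA' : A <> setT)
    (hB : subgroup B) (hB' : B <> setT)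
    (hphi : subgroup_iso A B phi) :
  infinite_C_width (HNN A phi).
Proof.
exact: (infinite_C_width_of_hom_to_int _ _ _ (exponent_sumM G A phi)
          (exponent_sum_stable G A phi)).
Qed.
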